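(* There is an absolute constant $C>0$ such that for every $d\ge1$, every $\eta\in(0,1/4)$ and every step size $0<h\le1$, the spectral gap $\lambda$ of MALA with target distribution $\pi_\eta$ on $\mathbb R^d$ and step size $h$ satisfies $\lambda\le C\,h$.
   Context: For $\eta\in(0,1/4)$, $\pi_\eta$ is the probability measure on $\mathbb R^d$ with density $\propto\exp(-V_\eta)$, where $V_\eta(x)=\frac{\|x\|^2}{2}-\frac{1}{2d^{2\eta}}\sum_{i=1}^d\cos(d^\eta x_i)$. MALA with target $\pi\propto\exp(-V)$ and step size $h>0$: the proposal kernel $Q(x,\cdot)$ is the Gaussian $\mathcal N(x-h\nabla V(x),2hI_d)$ with density $Q(x,y)$; acceptance probability $A(x,y)=\min\bigl\{1,\frac{\pi(y)Q(y,x)}{\pi(x)Q(x,y)}\bigr\}$; the MALA kernel is $T(x,B)=\int_BQ(x,y)A(x,y)\,dy+\mathbf 1_B(x)\bigl(1-\int_{\mathbb R^d}Q(x,y)A(x,y)\,dy\bigr)$. The Dirichlet form is $\mathcal E(f,g)=\mathbb E_\pi[f\,(\mathrm{id}-T)g]$ for $f,g\in L^2(\pi)$, with $(Tg)(x)=\int g(y)\,T(x,dy)$, and the spectral gap is $\lambda=\inf\bigl\{\frac{\mathcal E(f,f)}{\mathrm{Var}_\pi f}:f\in L^2(\pi),\ \mathrm{Var}_\pi f>0\bigr\}$. *)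

(* Defs.v *)
From HB Require Import structures.
From mathcomp Require Import all_boot all_order all_algebra.
From mathcomp Require Import all_classical all_reals all_analysis.
From mathcomp Require Import measurable_realfun.
Import Order.TTheory GRing.Theory Num.Theory.
Import numFieldNormedType.Exports.

Set Implicit Arguments.
Unset Strict Implicit.
Unset Printing Implicit Defensive.

Local Open Scope classical_set_scope.
Local Open Scope ring_scope.

(* R^d with the product sigma-algebra; [measurableTypeR R] is R with the Borel
   sigma-algebra on which the library's [lebesgue_measure] lives. *)
Notation euclidean R d := (d.-tuple (measurableTypeR R)).

(* Lebesgue measure on R^d: the iterated product of [lebesgue_measure],
   transported along (t, x) |-> t :: x. *)
Fixpoint lebesgue_tuple (R : realType) (d : nat) :
    set (euclidean R d) -> \bar R :=
  match d with
  | 0 => \d_[tuple]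
  | d'.+1 => pushforward (lebesgue_measure \x @lebesgue_tuple R d')%E
                         (fun z => [tuple of z.1 :: z.2])
  end.
Arguments lebesgue_tuple {R d}.

Section mala.
Context (R : realType) (d : nat).
Local Notation Rd := (euclidean R d).
Implicit Types (V : Rd -> R) (x y m : Rd) (h : R).

Definition sqnorm x : R := \sum_(i < d) (tnth x i : R) ^+ 2.

(* i-th coordinate: derivative at x_i of t |-> V (x_1, .., t, .., x_d) *)
Definition gradient V x : Rd :=
  [tuple derive1 (fun t : R => V [tuple if j == i then t else tnth x j | j < d])
                 (tnth x i) | i < d].

Definition partition_function V : \bar R :=
  (\int[lebesgue_tuple]_x (expR (- V x))%:E)%E.

Definition gibbs_pdf V x : R := expR (- V x) / fine (partition_function V).

Definition gibbs V (A : set Rd) : \bar R :=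
  (\int[lebesgue_tuple]_(x in A) (gibbs_pdf V x)%:E)%E.

(* density of N(m, s2 I_d) *)
Definition gaussian_pdf m (s2 : R) y : R :=
  (2 * pi * s2) `^ (- (d%:R / 2)) *
  expR (- sqnorm [tuple (tnth y i : R) - tnth m i | i < d] / (2 * s2)).

Definition mala_proposal_pdf V h x y : R :=
  gaussian_pdf [tuple (tnth x i : R) - h * tnth (gradient V x) i | i < d]
               (2 * h) y.

Definition mala_acceptance V h x y : R :=
  Num.min 1 (gibbs_pdf V y * mala_proposal_pdf V h y x /
             (gibbs_pdf V x * mala_proposal_pdf V h x y)).

Definition mala_kernel V h x (B : set Rd) : \bar R :=
  (\int[lebesgue_tuple]_(y in B)
      (mala_proposal_pdf V h x y * mala_acceptance V h x y)%:E +
   (\1_B x)%:E *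
   (1 - \int[lebesgue_tuple]_y
          (mala_proposal_pdf V h x y * mala_acceptance V h x y)%:E))%E.

Definition cos_potential (eta : R) x : R :=
  sqnorm x / 2 -
  (2 * d%:R `^ (2 * eta))^-1 *
    \sum_(i < d) cos (d%:R `^ eta * (tnth x i : R)).

Definition pi_eta (eta : R) : set Rd -> \bar R := gibbs (cos_potential eta).

End mala.
Arguments cos_potential {R} d eta x.
Arguments pi_eta {R} d eta.

Section spectral_gap.
Context d (T : measurableType d) (R : realType).
Variables (P : probability T R) (K : T -> set T -> \bar R).

(* (K g)(x); [fine] is only there to land in R: for K the MALA kernel of
   [pi_eta] and g in L^2([pi_eta]), g is K(x, .)-integrable for every x. *)
Definition kernel_op (g : T -> R) (x : T) : R := fine (\int[K x]_y (g y)%:E)%E.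

Definition dirichlet_form (f g : T -> R) : \bar R :=
  ('E_P[(fun x => f x * (g x - kernel_op g x))%R])%E.

(* For f in L^2(P) the variance is finite, so [/] is the real division; the
   infimum is taken in [\bar R]. *)
Definition spectral_gap : \bar R :=
  ereal_inf [set (dirichlet_form f f / 'V_P[f])%E |
             f in [set f : T -> R | f \in Lfun P 2%:E /\ (0 < 'V_P[f])%E]].

End spectral_gap.

Section lebesgue_tuple_measure.
Context (R : realType).
Local Notation mR := (measurableTypeR R).

Let cns d (z : (mR * euclidean R d)%type) : euclidean R d.+1 :=
  [tuple of z.1 :: z.2].

Let mcns d : measurable_fun setT (@cns d).
Proof. exact: measurable_cons. Qed.

Let ucns d (x : euclidean R d.+1) : (mR * euclidean R d)%type :=
  (thead x, [tuple of behead x]).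

Let mucns d : measurable_fun setT (@ucns d).
Proof.
apply/measurable_fun_pair => /=; last exact: measurable_behead.
exact: measurable_tnth.
Qed.

Let cnsK d : cancel (@cns d) (@ucns d).
Proof.
by case=> t x; rewrite /ucns /cns/= theadE; congr pair; exact/val_inj.
Qed.

Lemma lebesgue_tuple_sigma_finite_measure d :
  {mu : {sigma_finite_measure set (euclidean R d) -> \bar R} |
   mu = lebesgue_tuple :> (set (euclidean R d) -> \bar R)}.
Proof.
elim: d => [|d [mu muE]]; first by exists (\d_[tuple]).
pose nu := measure_function_pushforward__canonical__measure_function_Measure
  (lebesgue_integral_fubini_product_measure1__canonical__measure_function_Measure
     (@lebesgue_measure R) mu)
  (@mcns d).
have nu_sf : sigma_finite setT nu.
  have /sigma_finiteP[F [TF ndF Foo]] := sigma_finiteT (@lebesgue_measure R).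
  have /sigma_finiteP[G [TG ndG Goo]] := sigma_finiteT mu.
  have TFG : setT = \bigcup_k (F k `*` G k).
    rewrite -setXTT TF TG predeqE => -[x y]; split; last first.
      by move=> [n _ []/= ? ?]; split; exists n.
    move=> [/= [n _ Fnx] [k _ Gky]]; exists (maxn n k) => //; split.
    - by move: x Fnx; exact/subsetPset/ndF/leq_maxl.
    - by move: y Gky; exact/subsetPset/ndG/leq_maxr.
  exists (fun k => @ucns d @^-1` (F k `*` G k)).
    by rewrite -preimage_bigcup -TFG preimage_setT.
  move=> k; have [mF Fk] := Foo k; have [mG Gk] := Goo k; split.
    by rewrite -[X in measurable X]setTI; apply: mucns => //; exact: measurableX.
  rewrite /nu /= /pushforward -comp_preimage.
  rewrite (_ : _ \o _ = id); last by apply/funext => z; exact: cnsK.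
  by rewrite preimage_id product_measure1E// lte_mul_pinfty// ge0_fin_numE.
pose nu_s := Measure_isSigmaFinite.Build _ _ _ nu nu_sf.
pose nu' : {sigma_finite_measure set (euclidean R d.+1) -> \bar R} :=
  HB.pack (nu : set (euclidean R d.+1) -> \bar R) (Measure.on nu) nu_s.
by exists nu'; rewrite /= /nu /= -muE.
Qed.

Let leb d := projT1 (lebesgue_tuple_sigma_finite_measure d).
Let lebE d : @lebesgue_tuple R d = leb d :> (set _ -> \bar R).
Proof. by rewrite /leb; case: lebesgue_tuple_sigma_finite_measure. Qed.

Let leb0 d : @lebesgue_tuple R d set0 = 0%E.
Proof. by rewrite lebE measure0. Qed.

Let leb_ge0 d (A : set (euclidean R d)) : (0 <= lebesgue_tuple A)%E.
Proof. by rewrite lebE measure_ge0. Qed.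

Let leb_sigma_additive d : semi_sigma_additive (@lebesgue_tuple R d).
Proof. by rewrite lebE; exact: measure_semi_sigma_additive. Qed.

HB.instance Definition _ d := isMeasure.Build _ _ _ (@lebesgue_tuple R d)
  (@leb0 d) (@leb_ge0 d) (@leb_sigma_additive d).

Let leb_sigma_finite d : sigma_finite setT (@lebesgue_tuple R d).
Proof. by rewrite lebE; exact: sigma_finiteT. Qed.

HB.instance Definition _ d := Measure_isSigmaFinite.Build _ _ _
  (@lebesgue_tuple R d) (@leb_sigma_finite d).

Lemma integral_lebesgue_tuple_prod d (f : 'I_d -> R -> R)
    (I : 'I_d -> R) :
  (forall i, measurable_fun setT (f i)) -> (forall i t, 0 <= f i t) ->
  (forall i, \int[lebesgue_measure]_t (f i t)%:E = (I i)%:E)%E ->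
  (\int[lebesgue_tuple]_(x in [set: euclidean R d])
     (\prod_(i < d) f i (tnth x i))%:E = (\prod_(i < d) I i)%:E)%E.
Proof.
elim: d => [|d IHd] in f I *; move=> mf f0 fI.
  under eq_integral do rewrite big_ord0.
  by rewrite big_ord0 integral_cst//= diracT mule1.
have mprod n (g : 'I_n -> R -> R) : (forall i, measurable_fun setT (g i)) ->
    measurable_fun setT (fun x : euclidean R n => \prod_(i < n) g i (tnth x i)).
  move=> mg; apply: measurable_prod => i _.
  by apply: measurableT_comp (mg i) _; exact: measurable_tnth.
have mF : measurable_fun setT (fun x : euclidean R d.+1 =>
    (\prod_(i < d.+1) f i (tnth x i))%:E).
  by apply/measurable_EFinP; exact: mprod.
rewrite /= (@ge0_integral_pushforward _ _ _ _ _ _ (@mcns d)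
  (lebesgue_integral_fubini_product_measure1__canonical__measure_function_Measure
     (@lebesgue_measure R) (@lebesgue_tuple R d)))//; last first.
  by move=> x _; rewrite lee_fin prodr_ge0.
rewrite preimage_setT/= (@fubini_tonelli1 _ _ _ _ _ lebesgue_measure); last 2 first.
- exact: (measurableT_comp mF (@mcns d)).
- by move=> z /=; rewrite lee_fin prodr_ge0.
rewrite big_ord_recl EFinM -fI /fubini_F.
transitivity (\int[lebesgue_measure]_t
    ((f ord0 t)%:E * (\prod_(i < d) I (lift ord0 i))%:E))%E.
  apply: eq_integral => t _ /=.
  transitivity (\int[lebesgue_tuple]_(x in [set: euclidean R d])
      ((f ord0 t)%:E * (\prod_(i < d) f (lift ord0 i) (tnth x i))%:E))%E.
    apply: eq_integral => x _; rewrite big_ord_recl -EFinM tnth0.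
    by congr ((_ * _)%:E); apply: eq_bigr => i _; rewrite tnthS.
  rewrite ge0_integralZl//; last 3 first.
  - by apply/measurable_EFinP; apply: (mprod _ (fun i => f (lift ord0 i))).
  - by move=> x _; rewrite lee_fin prodr_ge0.
  - by rewrite lee_fin.
  by rewrite (IHd (fun i => f (lift ord0 i)) (fun i => I (lift ord0 i))).
rewrite ge0_integralZr//.
- by apply/measurable_EFinP; exact: mf.
- by move=> x _; rewrite lee_fin.
rewrite lee_fin prodr_ge0// => i _.
by rewrite -lee_fin -fI integral_ge0// => x _; rewrite lee_fin.
Qed.

End lebesgue_tuple_measure.

(* Since |cos| <= 1, exp (- cos_potential) lies between two positive multiples
   of the standard Gaussian density, so the normalization of [pi_eta] is
   legitimate and [pi_eta] is canonically a [probability]. *)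
Section pi_eta_probability.
Context (R : realType) (d : nat) (eta : R).
Local Notation Rd := (euclidean R d).

Lemma measurable_sqnorm : measurable_fun setT (@sqnorm R d).
Proof.
apply: (@measurable_sum _ _ _ _ _ _ (fun i (x : Rd) => (tnth x i : R) ^+ 2)) => i.
by apply: measurable_funX; exact: measurable_tnth.
Qed.

Lemma measurable_cos_potential : measurable_fun setT (@cos_potential R d eta).
Proof.
apply: measurable_funB.
  by apply: measurable_funM => //; exact: measurable_sqnorm.
apply: measurable_funM => //.
apply: (@measurable_sum _ _ _ _ _ _
  (fun i (x : Rd) => cos (d%:R `^ eta * (tnth x i : R)))) => i.
apply: measurableT_comp.
  by apply: continuous_measurable_fun; exact: continuous_cos.
by apply: measurable_funM => //; exact: measurable_tnth.
Qed.

Let c := (2 * d%:R `^ (2 * eta))^-1 : R.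
Let c0 : 0 <= c. Proof. by rewrite invr_ge0 mulr_ge0// powR_ge0. Qed.

Let expVE (x : Rd) : expR (- cos_potential d eta x) =
  \prod_(i < d) (expR (c * cos (d%:R `^ eta * (tnth x i : R))) *
                 (normal_peak 1)^-1 * normal_pdf 0 1 (tnth x i)).
Proof.
rewrite /cos_potential -/c opprB expRD mulr_sumr /sqnorm mulr_suml -sumrN.
rewrite !expR_sum -big_split/=; apply: eq_bigr => i _.
rewrite normal_pdfE ?oner_eq0//= -mulrA; congr *%R.
rewrite mulKf ?gt_eqF ?normal_peak_gt0 ?oner_eq0//.
by rewrite /normal_fun subr0 expr1n mulNr.
Qed.

Let bnd (s : R) := expR s * (normal_peak 1)^-1.

Let bnd_gt0 s : 0 < bnd s.
Proof. by rewrite mulr_gt0 ?expR_gt0// invr_gt0 normal_peak_gt0// oner_eq0. Qed.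

Let integral_bnd s :
  (\int[lebesgue_tuple]_(x in [set: Rd])
     (\prod_(i < d) (bnd s * normal_pdf 0 1 (tnth x i)))%:E =
   (\prod_(i < d) bnd s)%:E)%E.
Proof.
apply: (@integral_lebesgue_tuple_prod R d
  (fun _ t => bnd s * normal_pdf 0 1 t) (fun _ => bnd s)).
- by move=> _; apply: measurable_funM => //; exact: measurable_normal_pdf.
- by move=> _ t; rewrite mulr_ge0 ?normal_pdf_ge0// ltW.
move=> _; under eq_integral do rewrite EFinM.
rewrite ge0_integralZl//.
- by rewrite integral_normal_pdf mule1.
- by apply/measurable_EFinP; exact: measurable_normal_pdf.
- by move=> t _; rewrite lee_fin normal_pdf_ge0.
- by rewrite lee_fin ltW.
Qed.

Let mexpV : measurable_fun setT (fun x : Rd => (expR (- cos_potential d eta x))%:E).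
Proof.
apply/measurable_EFinP; apply: measurableT_comp; first exact: measurable_expR.
by apply: measurableT_comp => //; exact: measurable_cos_potential.
Qed.

Let mbnd s : measurable_fun setT (fun x : Rd =>
  (\prod_(i < d) (bnd s * normal_pdf 0 1 (tnth x i)))%:E).
Proof.
apply/measurable_EFinP.
apply: (@measurable_prod _ _ _ _ _ _
  (fun i (x : Rd) => bnd s * normal_pdf 0 1 (tnth x i))) => i _.
apply: measurable_funM => //.
by apply: measurableT_comp; [exact: measurable_normal_pdf|exact: measurable_tnth].
Qed.

Lemma partition_function_gt0 :
  (0 < partition_function (@cos_potential R d eta))%E.
Proof.
have : (\int[lebesgue_tuple]_(x in [set: Rd])
     (\prod_(i < d) (bnd (- c) * normal_pdf 0 1 (tnth x i)))%:E <=
   partition_function (@cos_potential R d eta))%E.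
  apply: ge0_le_integral => //.
  - move=> x _; rewrite lee_fin prodr_ge0// => i _.
    by rewrite mulr_ge0 ?normal_pdf_ge0// ltW.
  - move=> x _; rewrite lee_fin expVE ler_prod// => i _.
    rewrite mulr_ge0 ?normal_pdf_ge0 ?(ltW (bnd_gt0 _))//=.
    rewrite ler_wpM2r ?normal_pdf_ge0// ler_wpM2r//.
      by rewrite invr_ge0 normal_peak_ge0.
    by rewrite ler_expR -mulrN1 ler_wpM2l// cos_geN1.
apply: lt_le_trans; rewrite integral_bnd lte_fin.
by apply: prodr_gt0 => i _; exact: bnd_gt0.
Qed.

Lemma partition_function_lty :
  (partition_function (@cos_potential R d eta) < +oo)%E.
Proof.
apply: (@le_lt_trans _ _ (\int[lebesgue_tuple]_(x in [set: Rd])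
     (\prod_(i < d) (bnd c * normal_pdf 0 1 (tnth x i)))%:E)%E); last first.
  by rewrite integral_bnd ltry.
apply: ge0_le_integral => //.
  move=> x _; rewrite lee_fin expVE ler_prod// => i _.
  rewrite !mulr_ge0 ?normal_pdf_ge0 ?expR_ge0 ?invr_ge0 ?normal_peak_ge0//=.
  rewrite ler_wpM2r ?normal_pdf_ge0// ler_wpM2r//.
    by rewrite invr_ge0 normal_peak_ge0.
  by rewrite ler_expR -[leRHS]mulr1 ler_wpM2l// cos_le1.
Qed.

Let Z := fine (partition_function (@cos_potential R d eta)).

Let Z_gt0 : 0 < Z.
Proof.
by rewrite fine_gt0// partition_function_gt0 partition_function_lty.
Qed.

Let pdf_ge0 (x : Rd) : (0 <= (gibbs_pdf (@cos_potential R d eta) x)%:E)%E.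
Proof. by rewrite lee_fin divr_ge0 ?expR_ge0// ltW. Qed.

Let mpdf : measurable_fun setT
  (fun x : Rd => (gibbs_pdf (@cos_potential R d eta) x)%:E).
Proof.
apply/measurable_EFinP; apply: measurable_funM => //.
exact/measurable_EFinP.
Qed.

Let pi0 : pi_eta d eta set0 = 0%E.
Proof. by rewrite /pi_eta /gibbs integral_set0. Qed.

Let pi_ge0 (A : set Rd) : (0 <= pi_eta d eta A)%E.
Proof. by apply: integral_ge0. Qed.

Let pi_sigma_additive : semi_sigma_additive (@pi_eta R d eta).
Proof.
move=> A mA tA mUA; rewrite /pi_eta /gibbs ge0_integral_bigcup//; last first.
  exact: measurable_funTS.
by apply: is_cvg_ereal_nneg_natsum_cond => n _ _; exact: pi_ge0.
Qed.

HB.instance Definition _ := isMeasure.Build _ _ _ (@pi_eta R d eta)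
  pi0 pi_ge0 pi_sigma_additive.

Let pi_setT : pi_eta d eta [set: Rd] = 1%E.
Proof.
rewrite /pi_eta /gibbs.
under eq_integral do rewrite /gibbs_pdf EFinM.
rewrite ge0_integralZr//.
- rewrite -/(partition_function _) -/Z -[partition_function _]fineK; last first.
    by rewrite gt0_fin_numE ?partition_function_gt0 ?partition_function_lty.
  by rewrite -/Z -EFinM divff// gt_eqF.
- by rewrite lee_fin invr_ge0 ltW.
Qed.

HB.instance Definition _ := Measure_isProbability.Build _ _ _
  (@pi_eta R d eta) pi_setT.

End pi_eta_probability.

(* Main.v *)
Require Import Defs.
From HB Require Import structures.
From mathcomp Require Import all_boot all_order all_algebra.
From mathcomp Require Import all_classical all_reals all_analysis.
From mathcomp Require Import measurable_realfun ring lra.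
Import Order.TTheory GRing.Theory Num.Theory.
Import numFieldNormedType.Exports.
Local Open Scope classical_set_scope.
Local Open Scope ring_scope.

(** The spectral gap is an infimum of Rayleigh quotients, so one test function
    is enough: the first coordinate [x_1], which a step of MALA moves by only
    about [sqrt h].  It is shifted and clipped to the values between 0 and 2,
    because for a bounded nonnegative function every integral below is either
    finite or the integral of a nonnegative function.

    The MALA kernel jumps from [x] according to a density [k x y] and otherwise
    stays put, and [k] is in detailed balance with the density [p] of the
    target.  For such a kernel and a bounded [f], symmetrizing gives
    [2 E(f, f) = \int \int p(x) k(x, y) (f x - f y)^2 dy dx]
    ([dirichlet_form_jump]).  The acceptance probability is at most 1, so [k]
    may be replaced by the Gaussian proposal density, and clipping is
    1-Lipschitz, so the form is at most half the mean squared displacement of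
    [x_1] under the proposal.  That displacement is a Gaussian of variance
    [2 h] plus a drift of size at most [h (|x_1| + 1/2)]; as [h <= 1], its
    second moment given [x] is at most [h (34 + 4 x_1^2)]
    ([mala_proposal_cos_sqr_step_le]).

    Everything else happens in one dimension.  The potential is a sum over
    coordinates, so the target is a product measure, each factor being the
    standard Gaussian reweighted by the exponential of
    [cos (b t) / (2 b^2)] with [b = d^eta >= 1].  That exponent is at most 1/2
    in absolute value whatever [d] and [eta] are, so the factor lies between
    [1/e] and [e] times the Gaussian density ([cos_pdf_ge], [cos_pdf_le]).
    This bounds the second moment of [x_1] from above ([sqr_cos_pdf_le]) and
    the variance of the clipped coordinate from below ([variance_clip_ge]), in
    both cases by absolute constants. *)

Set Implicit Arguments.
Unset Strict Implicit.

(** * Measures with a density *)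

Section density.
Local Open Scope ereal_scope.
Context d (T : measurableType d) (R : realType) (mu : {measure set T -> \bar R}).

Lemma density_measure (g : T -> R) :
  measurable_fun setT g -> (forall x, 0 <= g x)%R ->
  {nu : {measure set T -> \bar R} |
   nu = (fun A => \int[mu]_(x in A) (g x)%:E) :> (set T -> \bar R)}.
Proof.
move=> mg g0; pose nu (A : set T) := \int[mu]_(x in A) (g x)%:E.
have nu_set0 : nu set0 = 0 by rewrite /nu integral_set0.
have nu_ge0 A : 0 <= nu A by apply: integral_ge0 => x _; rewrite lee_fin.
have nu_sadd : semi_sigma_additive nu.
  move=> A mA tA mUA; rewrite /nu ge0_integral_bigcup//; first last.
  - by move=> x _; rewrite lee_fin.
  - by apply: measurable_funTS; exact/measurable_EFinP.
  by apply: is_cvg_ereal_nneg_natsum_cond => n _ _; exact: nu_ge0.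
pose nuM := isMeasure.Build _ _ _ nu nu_set0 nu_ge0 nu_sadd.
pose nu' : {measure set T -> \bar R} := HB.pack nu nuM.
by exists nu'.
Qed.

Import HBNNSimple.

(** Both sides are continuous under increasing limits in [F], so it is enough to
    treat simple functions. *)
Lemma ge0_integral_density (g : T -> R) (nu : {measure set T -> \bar R})
    (F : T -> \bar R) :
  measurable_fun setT g -> (forall x, 0 <= g x)%R ->
  (forall A, measurable A -> nu A = \int[mu]_(x in A) (g x)%:E) ->
  measurable_fun setT F -> (forall x, 0 <= F x) ->
  \int[nu]_x F x = \int[mu]_x (F x * (g x)%:E).
Proof.
move=> mg g0 nuE mF F0; pose h := nnsfun_approx measurableT mF.
have hF x : (h n x)%:E @[n --> \oo] --> F x by exact: cvg_nnsfun_approx.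
have h_nd x : {homo (fun n => h n x) : m n / (m <= n)%N >-> (m <= n)%R}.
  by move=> m n mn; exact/lefP/nd_nnsfun_approx.
have hnu : \int[nu]_x (h n x)%:E @[n --> \oo] --> \int[nu]_x F x.
  rewrite (_ : \int[nu]_x F x = \int[nu]_x limn (fun n => (h n x)%:E)).
    apply: cvg_monotone_convergence => //.
    - by move=> n; exact/measurable_EFinP.
    - by move=> n x _; rewrite lee_fin.
    - by move=> x _ m n mn; rewrite lee_fin h_nd.
  by apply: eq_integral => x _; apply/esym/cvg_lim => //; exact: hF.
have hmu : \int[mu]_x ((h n x)%:E * (g x)%:E) @[n --> \oo]
    --> \int[mu]_x (F x * (g x)%:E).
  rewrite (_ : \int[mu]_x (F x * (g x)%:E) =
      \int[mu]_x limn (fun n => (h n x)%:E * (g x)%:E)).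
    apply: cvg_monotone_convergence => //.
    - by move=> n; apply: emeasurable_funM; exact/measurable_EFinP.
    - by move=> n x _; rewrite mule_ge0// lee_fin.
    - by move=> x _ m n mn; rewrite lee_wpmul2r// lee_fin ?h_nd.
  by apply: eq_integral => x _; apply/esym/cvg_lim => //; apply: cvgeZr.
suff E n : \int[nu]_x (h n x)%:E = \int[mu]_x ((h n x)%:E * (g x)%:E).
  rewrite -(cvg_lim _ hnu)// -(cvg_lim _ hmu)//.
  by congr (limn _); apply/funext => n; exact: E.
rewrite integralT_nnsfun sintegralE.
under [RHS]eq_integral => x _.
  rewrite fimfunE -fsumEFin// ge0_mule_fsuml; last first.
    by move=> y; exact: nnfun_muleindic_ge0.
  over.
rewrite ge0_integral_fsum//; last 2 first.
- move=> r; apply: emeasurable_funM; last exact/measurable_EFinP.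
  by apply/measurable_EFinP; apply: measurable_funM.
- move=> r x _; apply: mule_ge0; last by rewrite lee_fin.
  exact: nnfun_muleindic_ge0.
apply: eq_fsbigr => r; rewrite inE => -[t _ <-{r}].
rewrite nuE//.
under [RHS]eq_integral do rewrite EFinM -muleA.
rewrite ge0_integralZl//; first last.
- by rewrite lee_fin.
- by move=> x _; rewrite mule_ge0 ?lee_fin.
- by apply: emeasurable_funM; exact/measurable_EFinP.
congr (_ * _); rewrite integral_mkcond; apply: eq_integral => x _.
by rewrite epatch_indic muleC.
Qed.

End density.

(** * The Dirichlet form of a reversible jump kernel *)

Section jump_kernel.
Local Open Scope ereal_scope.
Context d (T : measurableType d) (R : realType).
Context (mu : {sigma_finite_measure set T -> \bar R}) (P : probability T R).
Context (p : T -> R) (k : T -> T -> R) (K : T -> set T -> \bar R).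
Hypothesis mp : measurable_fun setT p.
Hypothesis p_ge0 : forall x, (0 <= p x)%R.
Hypothesis PE : forall A, measurable A -> P A = \int[mu]_(x in A) (p x)%:E.
Hypothesis mk : measurable_fun setT (fun z : T * T => k z.1 z.2).
Hypothesis k_ge0 : forall x y, (0 <= k x y)%R.
Hypothesis k_le1 : forall x, \int[mu]_y (k x y)%:E <= 1.
Hypothesis k_reversible : forall x y, (p x * k x y = p y * k y x)%R.
Hypothesis KE : forall x B, K x B =
  \int[mu]_(y in B) (k x y)%:E + (\1_B x)%:E * (1 - \int[mu]_y (k x y)%:E).

Let mkx x : measurable_fun setT (k x).
Proof. exact: (measurableT_comp mk (measurable_pair1 x)). Qed.

Let jump_rate x : R := fine (\int[mu]_y (k x y)%:E).

Let jump_rateE x : (jump_rate x)%:E = \int[mu]_y (k x y)%:E.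
Proof.
rewrite fineK// ge0_fin_numE; first exact: le_lt_trans (k_le1 x) (ltry _).
by apply: integral_ge0 => y _; rewrite lee_fin.
Qed.

Let jump_rate_ge0 x : (0 <= jump_rate x)%R.
Proof. by apply: fine_ge0; apply: integral_ge0 => y _; rewrite lee_fin. Qed.

Let jump_rate_le1 x : (jump_rate x <= 1)%R.
Proof. by rewrite -lee_fin jump_rateE. Qed.

(** [K x] is the sum of a measure with density [k x] and of an atom at [x] that
    carries the remaining mass. *)
Lemma integral_jump_kernel (F : T -> \bar R) x :
  measurable_fun setT F -> (forall y, 0 <= F y) ->
  \int[K x]_y F y =
  \int[mu]_y (F y * (k x y)%:E) + (1 - jump_rate x)%:E * F x.
Proof.
move=> mF F0; have [nu nuE] := density_measure mu (mkx x) (k_ge0 x).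
have r0 : (0 <= 1 - jump_rate x)%R by rewrite subr_ge0.
have -> : K x = measure_add nu (mscale (NngNum r0) (dirac x)).
  apply/funext => B; rewrite measure_addE KE nuE -jump_rateE -EFinB.
  by rewrite /mscale/= muleC.
rewrite ge0_integral_measure_add// ge0_integral_mscale// integral_dirac//.
rewrite diracT mul1e (ge0_integral_density (mu := mu) (mkx x) (k_ge0 x))//.
by move=> A mA; rewrite nuE.
Qed.

Context (f : T -> R) (M : R).
Hypothesis mf : measurable_fun setT f.
Hypothesis f_ge0 : forall x, (0 <= f x)%R.
Hypothesis f_leM : forall x, (f x <= M)%R.

Let jump_mean x : R := fine (\int[mu]_y (f y * k x y)%:E).

Let jump_mean_bnd x : \int[mu]_y (f y * k x y)%:E <= M%:E.
Proof.
apply: (@le_trans _ _ (\int[mu]_y (M%:E * (k x y)%:E))).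
  apply: ge0_le_integral => //.
  - by move=> y _; rewrite lee_fin mulr_ge0.
  - by apply/measurable_EFinP; apply: measurable_funM.
  - by apply: emeasurable_funM => //; exact/measurable_EFinP.
  - by move=> y _; rewrite -EFinM lee_fin ler_wpM2r.
have M0 : (0 <= M)%R by exact: le_trans (f_ge0 x) (f_leM x).
rewrite ge0_integralZl//; last 2 first.
- exact/measurable_EFinP.
- by move=> y _; rewrite lee_fin.
by rewrite -jump_rateE -EFinM lee_fin ler_piMr.
Qed.

Let jump_mean_int_ge0 x : 0 <= \int[mu]_y (f y * k x y)%:E.
Proof. by apply: integral_ge0 => y _; rewrite lee_fin mulr_ge0. Qed.

Let jump_meanE x : (jump_mean x)%:E = \int[mu]_y (f y * k x y)%:E.
Proof.
by rewrite fineK// ge0_fin_numE// (le_lt_trans (jump_mean_bnd x)) ?ltry.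
Qed.

Let kernel_op_jump x :
  kernel_op K f x = (jump_mean x + (1 - jump_rate x) * f x)%R.
Proof.
rewrite /kernel_op integral_jump_kernel//; last exact/measurable_EFinP.
under eq_integral do rewrite -EFinM.
by rewrite -jump_meanE -EFinM.
Qed.

(** The mass that flows from [z.1] to [z.2] in stationarity; detailed balance is
    its symmetry. *)
Let s (z : T * T) : R := (p z.1 * k z.1 z.2)%R.

Let ms : measurable_fun setT s.
Proof. by apply: measurable_funM => //; exact: measurableT_comp. Qed.

Let mf1 : measurable_fun setT (fun z : T * T => f z.1).
Proof. exact: measurableT_comp. Qed.

Let mf2 : measurable_fun setT (fun z : T * T => f z.2).
Proof. exact: measurableT_comp. Qed.

Let s_ge0 z : (0 <= s z)%R. Proof. exact: mulr_ge0. Qed.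

Let m_jump_rate : measurable_fun setT jump_rate.
Proof.
apply/measurable_EFinP; pose g (z : T * T) := (k z.1 z.2)%:E.
rewrite (_ : _ \o _ = fubini_F mu g); last first.
  by apply/funext => x; exact: jump_rateE.
apply: measurable_fun_fubini_tonelli_F.
  exact/measurable_EFinP.
by move=> z; rewrite /g lee_fin.
Qed.

Let m_jump_mean : measurable_fun setT jump_mean.
Proof.
apply/measurable_EFinP; pose g (z : T * T) := (f z.2 * k z.1 z.2)%:E.
rewrite (_ : _ \o _ = fubini_F mu g); last first.
  by apply/funext => x; exact: jump_meanE.
apply: measurable_fun_fubini_tonelli_F.
  by apply/measurable_EFinP; apply: measurable_funM.
by move=> z; rewrite /g lee_fin mulr_ge0.
Qed.

Let jump_square_meanE :
  \int[P]_x (f x * f x * jump_rate x)%:E =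
  \int[mu \x mu]_z (f z.1 * f z.1 * s z)%:E.
Proof.
rewrite (ge0_integral_density mp p_ge0 PE); last 2 first.
- by apply/measurable_EFinP; apply: measurable_funM => //; exact: measurable_funM.
- by move=> x; rewrite lee_fin !mulr_ge0.
rewrite fubini_tonelli1; last 2 first.
- apply/measurable_EFinP; apply: measurable_funM => //; exact: measurable_funM.
- by move=> z /=; rewrite lee_fin !mulr_ge0.
apply: eq_integral => x _; rewrite /fubini_F /s/=.
under [RHS]eq_integral do rewrite mulrA EFinM.
rewrite ge0_integralZl//; last 3 first.
- exact/measurable_EFinP.
- by move=> y _; rewrite lee_fin.
- by rewrite lee_fin !mulr_ge0.
by rewrite -jump_rateE -!EFinM mulrAC.
Qed.

Let jump_cross_meanE :
  \int[P]_x (f x * jump_mean x)%:E =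
  \int[mu \x mu]_z (f z.1 * f z.2 * s z)%:E.
Proof.
have L0 x : (0 <= jump_mean x)%R by exact: fine_ge0.
rewrite (ge0_integral_density mp p_ge0 PE); last 2 first.
- by apply/measurable_EFinP; apply: measurable_funM.
- by move=> x; rewrite lee_fin !mulr_ge0.
rewrite fubini_tonelli1; last 2 first.
- apply/measurable_EFinP; apply: measurable_funM => //; exact: measurable_funM.
- by move=> z /=; rewrite lee_fin !mulr_ge0.
apply: eq_integral => x _; rewrite /fubini_F /s/=.
transitivity (\int[mu]_y ((f x * p x)%:E * (f y * k x y)%:E)); last first.
  by apply: eq_integral => y _; rewrite -EFinM; congr EFin; ring.
rewrite ge0_integralZl//; last 3 first.
- by apply/measurable_EFinP; apply: measurable_funM.
- by move=> y _; rewrite lee_fin mulr_ge0.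
- by rewrite lee_fin !mulr_ge0.
by rewrite -jump_meanE -!EFinM mulrAC.
Qed.

Let jump_square_swap :
  \int[mu \x mu]_z (f z.1 * f z.1 * s z)%:E =
  \int[mu \x mu]_z (f z.2 * f z.2 * s z)%:E.
Proof.
have mh : measurable_fun setT (fun z : T * T => (f z.2 * f z.2 * s z)%:E).
  apply/measurable_EFinP; apply: measurable_funM => //; exact: measurable_funM.
have h0 (z : T * T) : 0 <= (f z.2 * f z.2 * s z)%:E.
  by rewrite lee_fin !mulr_ge0.
rewrite fubini_tonelli1; last 2 first.
- apply/measurable_EFinP; apply: measurable_funM => //; exact: measurable_funM.
- by move=> z /=; rewrite lee_fin !mulr_ge0.
rewrite (fubini_tonelli1 _ mh h0) (fubini_tonelli _ mh h0).
apply: eq_integral => x _.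
by apply: eq_integral => y _; rewrite /s/= k_reversible.
Qed.

(** Expanding [f (f - K f)], the holding terms cancel and the form is the
    integral of [f(x)^2 s] minus that of [f(x) f(y) s].  By symmetry of the flow
    [s] the first one is also the integral of [f(y)^2 s], and the sum of the two
    ways of writing the difference is the integral of the square. *)
Lemma dirichlet_form_jump :
  2%:E * dirichlet_form P K f f =
  \int[mu]_x \int[mu]_y (p x * k x y * (f x - f y) ^+ 2)%:E.
Proof.
have L0 x : (0 <= jump_mean x)%R by exact: fine_ge0.
have LM x : (jump_mean x <= M)%R.
  by rewrite -lee_fin jump_meanE; exact: jump_mean_bnd.
have Pfin (h : T -> R) c : measurable_fun setT h ->
    (forall x, 0 <= h x)%R -> (forall x, h x <= c)%R ->
    P.-integrable setT (EFin \o h).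
  move=> mh h0 hc; apply: measurable_bounded_integrable => //.
    by rewrite -ge0_fin_numE//; exact: fin_num_measure.
  exists c; split; first exact: num_real.
  by move=> e ce x _ /=; rewrite ger0_norm// (le_trans (hc x))// ltW.
have iA : P.-integrable setT (EFin \o (fun x => f x * f x * jump_rate x)%R).
  apply: (Pfin _ (M * M)%R).
  - by apply: measurable_funM => //; apply: measurable_funM.
  - by move=> x; rewrite !mulr_ge0.
  - by move=> x; rewrite -[leRHS]mulr1 ler_pM ?mulr_ge0// ler_pM.
have iB : P.-integrable setT (EFin \o (fun x => f x * jump_mean x)%R).
  apply: (Pfin _ (M * M)%R).
  - exact: measurable_funM.
  - by move=> x; rewrite mulr_ge0.
  - by move=> x; rewrite ler_pM.
have -> : dirichlet_form P K f f =
    \int[P]_x (f x * f x * jump_rate x)%:E - \int[P]_x (f x * jump_mean x)%:E.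
  rewrite -integralB_EFin// /dirichlet_form unlock. apply: eq_integral => x _.
  by rewrite kernel_op_jump -EFinB; congr EFin; ring.
have -> : \int[mu]_x \int[mu]_y (p x * k x y * (f x - f y) ^+ 2)%:E =
    \int[mu \x mu]_z (s z * (f z.1 - f z.2) ^+ 2)%:E.
  rewrite fubini_tonelli1//.
  - apply/measurable_EFinP; apply: measurable_funM => //.
    by apply: measurable_funX; exact: measurable_funB.
  - by move=> z /=; rewrite lee_fin mulr_ge0// sqr_ge0.
have := integrable_fin_num measurableT iA.
have := integrable_fin_num measurableT iB.
rewrite /= jump_square_meanE jump_cross_meanE.
set A := (X in _ * (X - _)); set B := (X in _ * (_ - X)); set D := (RHS).
move=> Bf Af; have [Afin Bfin] : A \is a fin_num /\ B \is a fin_num by [].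
clear Af Bf.
(* Since subtraction on extended reals is partial, the identity is proved in its
   additive form, where all terms are nonnegative. *)
suff DB : D + (B + B) = A + A.
  have -> : D = A + A - (B + B) by rewrite -DB addeK// fin_numD Bfin.
  rewrite -(fineK Afin) -(fineK Bfin) -!(EFinD, EFinN, EFinM).
  by congr EFin; ring.
rewrite {2}/A jump_square_swap /A /B /D.
have mff (u v : T * T -> R) : measurable_fun setT u -> measurable_fun setT v ->
    measurable_fun setT (fun z => (u z * v z * s z)%:E).
  move=> mu' mv'; apply/measurable_EFinP; apply: measurable_funM => //.
  exact: measurable_funM.
have mD : measurable_fun setT (fun z => (s z * (f z.1 - f z.2) ^+ 2)%:E).
  apply/measurable_EFinP; apply: measurable_funM => //.
  by apply: measurable_funX; exact: measurable_funB.
rewrite -!ge0_integralD//; try exact: mff;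
  try (by move=> z _; rewrite lee_fin !mulr_ge0).
- by apply: eq_integral => z _; rewrite -!EFinD; congr EFin; ring.
- by move=> z _; rewrite lee_fin mulr_ge0// sqr_ge0.
- by move=> z _; rewrite adde_ge0// lee_fin !mulr_ge0.
- by apply: emeasurable_funD; exact: mff.
Qed.

End jump_kernel.

(** * Gaussian densities on the line *)

Section normal.
Context (R : realType).
Implicit Types (m s t : R).

(** A pointwise substitute for the second moment of a Gaussian: multiplying by
    the square costs a constant and a doubling of the deviation, because
    [u <= exp u] for [u = (t - m)^2 / (4 s^2)]. *)
Lemma sqr_normal_pdf_le m s t : 0 < s ->
  (t - m) ^+ 2 * normal_pdf m s t <= 8 * s ^+ 2 * normal_pdf m (2 * s) t.
Proof.
move=> s0; have s20 : 0 < 2 * s by rewrite mulr_gt0.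
have s2_gt0 : 0 < s ^+ 2 by rewrite exprn_gt0.
rewrite !normal_pdfE ?gt_eqF//.
have -> : normal_peak s = 2 * normal_peak (2 * s).
  rewrite /normal_peak (_ : (2 * s) ^+ 2 * pi *+ 2 = 2 ^+ 2 * (s ^+ 2 * pi *+ 2)).
    by rewrite sqrtrM// sqrtr_sqr ger0_norm// invfM mulrA mulfV ?mul1r.
  by ring.
rewrite /normal_fun; set v := (t - m) ^+ 2; set k := normal_peak _.
have k0 : 0 <= k by exact: normal_peak_ge0.
have v0 : 0 <= v by exact: sqr_ge0.
pose u := v / (4 * s ^+ 2).
have u0 : 0 <= u by rewrite divr_ge0// mulr_ge0// ltW.
have vE : v = 4 * s ^+ 2 * u by rewrite /u; field; rewrite gt_eqF.
have -> : - v / (s ^+ 2 *+ 2) = - u - u by rewrite /u; field; rewrite gt_eqF.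
have -> : - v / ((2 * s) ^+ 2 *+ 2) = - (u / 2).
  by rewrite /u; field; rewrite gt_eqF.
rewrite vE expRD.
have ue : u * expR (- u) <= 1.
  rewrite -(expRxMexpNx_1 u) ler_wpM2r ?expR_ge0//.
  by apply: le_trans (expR_ge1Dx u); rewrite lerDr.
have e2 : expR (- u) <= expR (- (u / 2)) by rewrite ler_expR; lra.
rewrite [leLHS](_ : _ = 8 * s ^+ 2 * k * (u * expR (- u) * expR (- u)));
  last by ring.
rewrite [leRHS]mulrA; apply: ler_wpM2l.
  by rewrite !mulr_ge0// ltW.
apply: le_trans e2; rewrite ler_piMl ?expR_ge0//.
Qed.

Lemma integral_scaled_normal_pdf (a m s : R) : 0 <= a ->
  (\int[lebesgue_measure]_t (a * normal_pdf m s t)%:E = a%:E)%E.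
Proof.
move=> a0; under eq_integral do rewrite EFinM.
rewrite ge0_integralZl//.
- by rewrite integral_normal_pdf mule1.
- by apply/measurable_EFinP; exact: measurable_normal_pdf.
- by move=> t _; rewrite lee_fin normal_pdf_ge0.
Qed.

Lemma normal_pdf01_ge t : `|t| <= 2 ->
  normal_peak 1 * expR (- 2) <= normal_pdf 0 1 t.
Proof.
move=> t2; rewrite normal_pdfE ?oner_eq0// ler_wpM2l ?normal_peak_ge0//.
rewrite /normal_fun subr0 expr1n ler_expR.
have : t ^+ 2 <= 2 ^+ 2 by rewrite -real_normK ?num_real// lerXn2r ?nnegrE.
by lra.
Qed.

End normal.

(** * The Gaussian tilted by a cosine *)

Section tilted_normal.
Context (R : realType) (b c : R).
Hypotheses (c_ge0 : 0 <= c) (c_le : c <= 2^-1).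

(** The density, up to a constant, of one coordinate of the target. *)
Definition cos_tilt (t : R) : R := expR (c * cos (b * t)) * normal_pdf 0 1 t.

Definition cos_tilt_mass : R := fine (\int[lebesgue_measure]_t (cos_tilt t)%:E)%E.

Definition cos_pdf (t : R) : R := cos_tilt t / cos_tilt_mass.

Lemma measurable_cos_tilt : measurable_fun setT cos_tilt.
Proof.
apply: measurable_funM; last exact: measurable_normal_pdf.
apply: measurableT_comp; first exact: measurable_expR.
apply: measurable_funM => //; apply: measurableT_comp.
  by apply: continuous_measurable_fun; exact: continuous_cos.
exact: measurable_funM.
Qed.

Lemma cos_tilt_ge0 t : 0 <= cos_tilt t.
Proof. by rewrite mulr_ge0 ?expR_ge0 ?normal_pdf_ge0. Qed.

Lemma cos_tilt_ge t : expR (- 2^-1) * normal_pdf 0 1 t <= cos_tilt t.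
Proof.
rewrite ler_wpM2r ?normal_pdf_ge0// ler_expR.
have := cos_geN1 (b * t); move: c_ge0 c_le; nra.
Qed.

Lemma cos_tilt_le t : cos_tilt t <= expR 2^-1 * normal_pdf 0 1 t.
Proof.
rewrite ler_wpM2r ?normal_pdf_ge0// ler_expR.
have := cos_le1 (b * t); move: c_ge0 c_le; nra.
Qed.

Let m_cos_tilt : measurable_fun setT (fun t => (cos_tilt t)%:E).
Proof. by apply/measurable_EFinP; exact: measurable_cos_tilt. Qed.

Let integral_cos_tilt_le :
  (\int[lebesgue_measure]_t (cos_tilt t)%:E <= (expR 2^-1)%:E)%E.
Proof.
rewrite -(integral_scaled_normal_pdf 0 1) ?expR_ge0//.
apply: ge0_le_integral => //.
- by move=> t _; rewrite lee_fin cos_tilt_ge0.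
- apply/measurable_EFinP; apply: measurable_funM => //.
  exact: measurable_normal_pdf.
- by move=> t _; rewrite lee_fin cos_tilt_le.
Qed.

Lemma integral_cos_tilt :
  (\int[lebesgue_measure]_t (cos_tilt t)%:E = cos_tilt_mass%:E)%E.
Proof.
rewrite fineK// ge0_fin_numE ?(le_lt_trans integral_cos_tilt_le) ?ltry//.
by apply: integral_ge0 => t _; rewrite lee_fin cos_tilt_ge0.
Qed.

Lemma cos_tilt_mass_le : cos_tilt_mass <= expR 2^-1.
Proof. by rewrite -lee_fin -integral_cos_tilt. Qed.

Lemma cos_tilt_mass_ge : expR (- 2^-1) <= cos_tilt_mass.
Proof.
rewrite -lee_fin -integral_cos_tilt -(integral_scaled_normal_pdf 0 1) ?expR_ge0//.
apply: ge0_le_integral => //.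
- by move=> t _; rewrite lee_fin mulr_ge0 ?expR_ge0 ?normal_pdf_ge0.
- apply/measurable_EFinP; apply: measurable_funM => //.
  exact: measurable_normal_pdf.
- by move=> t _; rewrite lee_fin cos_tilt_ge.
Qed.

Lemma cos_tilt_mass_gt0 : 0 < cos_tilt_mass.
Proof. by apply: lt_le_trans cos_tilt_mass_ge; exact: expR_gt0. Qed.

Lemma measurable_cos_pdf : measurable_fun setT cos_pdf.
Proof. by apply: measurable_funM => //; exact: measurable_cos_tilt. Qed.

Lemma cos_pdf_ge0 t : 0 <= cos_pdf t.
Proof. by rewrite divr_ge0 ?cos_tilt_ge0// ltW// cos_tilt_mass_gt0. Qed.

Lemma integral_cos_pdf : (\int[lebesgue_measure]_t (cos_pdf t)%:E = 1%:E)%E.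
Proof.
under eq_integral do rewrite EFinM.
rewrite ge0_integralZr//.
- by rewrite integral_cos_tilt -EFinM divff// gt_eqF// cos_tilt_mass_gt0.
- by move=> t _; rewrite lee_fin cos_tilt_ge0.
- by rewrite lee_fin invr_ge0 ltW// cos_tilt_mass_gt0.
Qed.

Lemma cos_pdf_le t : cos_pdf t <= expR 1 * normal_pdf 0 1 t.
Proof.
rewrite ler_pdivrMr ?cos_tilt_mass_gt0//; apply: le_trans (cos_tilt_le t) _.
rewrite mulrAC ler_wpM2r ?normal_pdf_ge0//.
rewrite (_ : 2^-1 = 1 - 2^-1 :> R); last by field.
by rewrite expRD ler_wpM2l ?expR_ge0// cos_tilt_mass_ge.
Qed.

Lemma cos_pdf_ge t : expR (- 1) * normal_pdf 0 1 t <= cos_pdf t.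
Proof.
rewrite ler_pdivlMr ?cos_tilt_mass_gt0//; apply: le_trans _ (cos_tilt_ge t).
rewrite mulrAC ler_wpM2r ?normal_pdf_ge0//.
rewrite (_ : - 2^-1 = - 1 + 2^-1 :> R); last by field.
by rewrite expRD ler_wpM2l ?expR_ge0// cos_tilt_mass_le.
Qed.

Lemma sqr_cos_pdf_le t : t ^+ 2 * cos_pdf t <= 8 * expR 1 * normal_pdf 0 2 t.
Proof.
have := @sqr_normal_pdf_le R 0 1 t ltr01.
rewrite subr0 expr1n !mulr1 => h.
apply: le_trans (_ : t ^+ 2 * (expR 1 * normal_pdf 0 1 t) <= _).
  by rewrite ler_wpM2l ?sqr_ge0// cos_pdf_le.
rewrite mulrCA [leRHS](_ : _ = expR 1 * (8 * normal_pdf 0 2 t)); last by ring.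
by rewrite ler_wpM2l ?expR_ge0.
Qed.

(** The bound [exp (-3)] is [exp (-1)] from the tilt times [exp (-2)] from the
    Gaussian on [-2, 2], which contains the support of the bump. *)
Lemma cos_pdf_bump_le (a t : R) : - 2 <= a -> a <= 1 -> 
  expR (- 3) * normal_peak 1 * \1_`[a, a + 1] t <= cos_pdf t.
Proof.
move=> a2 a1; rewrite indicE; case: (boolP (t \in _)) => [|_]; last first.
  by rewrite mulr0 cos_pdf_ge0.
rewrite inE/= in_itv/= mulr1 => /andP[at1 at2].
apply: le_trans (cos_pdf_ge t).
rewrite (_ : - 3 = - 1 - 2 :> R); last by ring.
rewrite expRD -mulrA ler_wpM2l ?expR_ge0// mulrC normal_pdf01_ge// ler_norml.
by apply/andP; split; lra.
Qed.

End tilted_normal.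

(** * Integrals against product densities *)

Section product_density.
Context (R : realType) (d : nat).
Local Notation Rd := (euclidean R d).
Local Open Scope ereal_scope.

Lemma integral_tuple_coordinate (j : 'I_d) (phi : R -> R) (psi : 'I_d -> R -> R)
    (I : R) :
  measurable_fun setT phi -> (forall t, 0 <= phi t)%R ->
  \int[lebesgue_measure]_t (phi t)%:E = I%:E ->
  (forall i, measurable_fun setT (psi i)) -> (forall i t, 0 <= psi i t)%R ->
  (forall i, \int[lebesgue_measure]_t (psi i t)%:E = 1%:E) ->
  \int[lebesgue_tuple]_(x in [set: Rd])
    (phi (tnth x j) * \prod_(i < d | i != j) psi i (tnth x i))%:E = I%:E.
Proof.
move=> mphi phi0 phiI mpsi psi0 psi1.
pose F i := if i == j then phi else psi i.
pose J i : R := if i == j then I else 1%R.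
have <- : (\prod_(i < d) J i = I)%R.
  rewrite (bigD1 j)//= {1}/J eqxx big1 ?mulr1// => i ij.
  by rewrite /J (negbTE ij).
rewrite -(@integral_lebesgue_tuple_prod R d F J).
- apply: eq_integral => x _; rewrite [in RHS](bigD1 j)//= /F eqxx.
  congr (_ * _)%:E.
  by apply: eq_bigr => i ij; rewrite (negbTE ij).
- by move=> i; rewrite /F; case: ifP.
- by move=> i t; rewrite /F; case: ifP.
- by move=> i; rewrite /F /J; case: ifP.
Qed.

(* The two lemmas below reduce an integral of a function of one coordinate
   against a product density to a pointwise comparison on the line. *)
Context (j : 'I_d) (psi : 'I_d -> R -> R) (g phi : R -> R) (I : R).
Hypotheses (mg : measurable_fun setT g) (g_ge0 : forall t, (0 <= g t)%R).
Hypotheses (mphi : measurable_fun setT phi) (phi_ge0 : forall t, (0 <= phi t)%R).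
Hypothesis phiI : \int[lebesgue_measure]_t (phi t)%:E = I%:E.
Hypothesis mpsi : forall i, measurable_fun setT (psi i).
Hypothesis psi_ge0 : forall i t, (0 <= psi i t)%R.
Hypothesis psi1 : forall i, \int[lebesgue_measure]_t (psi i t)%:E = 1%:E.

Let m_left : measurable_fun setT
  (fun x : Rd => (g (tnth x j) * \prod_(i < d) psi i (tnth x i))%:E).
Proof.
apply/measurable_EFinP; apply: measurable_funM.
  by apply: measurableT_comp => //; exact: measurable_tnth.
apply: (@measurable_prod _ _ _ _ _ _ (fun i (x : Rd) => psi i (tnth x i))) => i _.
by apply: (measurableT_comp (mpsi i)); exact: measurable_tnth.
Qed.

Let m_right : measurable_fun setT
  (fun x : Rd => (phi (tnth x j) * \prod_(i < d | i != j) psi i (tnth x i))%:E).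
Proof.
apply/measurable_EFinP; apply: measurable_funM.
  by apply: measurableT_comp => //; exact: measurable_tnth.
under eq_fun do rewrite -big_filter.
apply: (@measurable_prod _ _ _ _ _ _ (fun i (x : Rd) => psi i (tnth x i))) => i _.
by apply: (measurableT_comp (mpsi i)); exact: measurable_tnth.
Qed.

Lemma integral_tuple_coordinate_le : (forall t, g t * psi j t <= phi t)%R ->
  \int[lebesgue_tuple]_(x in [set: Rd])
    (g (tnth x j) * \prod_(i < d) psi i (tnth x i))%:E <= I%:E.
Proof.
move=> gphi.
rewrite -(integral_tuple_coordinate j mphi phi_ge0 phiI mpsi psi_ge0 psi1).
apply: ge0_le_integral => //.
- by move=> x _; rewrite lee_fin mulr_ge0// prodr_ge0.
- move=> x _; rewrite lee_fin (bigD1 j)//= mulrA ler_wpM2r//.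
  by rewrite prodr_ge0.
Qed.

Lemma integral_tuple_coordinate_ge : (forall t, phi t <= g t * psi j t)%R ->
  I%:E <= \int[lebesgue_tuple]_(x in [set: Rd])
    (g (tnth x j) * \prod_(i < d) psi i (tnth x i))%:E.
Proof.
move=> gphi.
rewrite -(integral_tuple_coordinate j mphi phi_ge0 phiI mpsi psi_ge0 psi1).
apply: ge0_le_integral => //.
- by move=> x _; rewrite lee_fin mulr_ge0// prodr_ge0.
- move=> x _; rewrite lee_fin [leRHS](_ : _ = (g (tnth x j) * psi j (tnth x j)) *
    \prod_(i < d | i != j) psi i (tnth x i))%R.
    by rewrite ler_wpM2r// prodr_ge0.
  by rewrite (bigD1 j)//= mulrA.
Qed.

End product_density.

(** * The densities of MALA for the cosine potential *)

(** The flow between two states is a minimum, hence symmetric: this is detailed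
    balance for the Metropolis acceptance rule. *)
Lemma metropolis_flow (R : realFieldType) (a a' q q' : R) : 0 < a -> 0 < q ->
  a * (q * Num.min 1 (a' * q' / (a * q))) = Num.min (a * q) (a' * q').
Proof.
move=> a0 q0; rewrite mulrA minr_pMr ?mulr_ge0 ?ltW// mulr1.
rewrite [X in Num.min _ X]mulrC divfK//.
by rewrite mulf_neq0// gt_eqF.
Qed.

Section mala_densities.
Context (R : realType) (d : nat) (eta h : R).
Hypotheses (d_gt0 : (0 < d)%N) (eta_gt0 : 0 < eta) (h_gt0 : 0 < h).
Local Notation Rd := (euclidean R d).
Implicit Types (x y : Rd).

(* In these terms the potential of one coordinate is [t^2 / 2 - c * cos (b * t)],
   with [c = 1 / (2 b^2)] and [b >= 1]. *)
Let b : R := d%:R `^ eta.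
Let c : R := (2 * d%:R `^ (2 * eta))^-1.
Local Notation V := (@cos_potential R d eta).

Let b_ge1 : 1 <= b.
Proof. by rewrite -(powRr0 d%:R) ler_powR ?ler1n ?ltW. Qed.

Let c_eq : c = (2 * b ^+ 2)^-1.
Proof. by rewrite /c /b [2 * eta]mulrC powRrM powR_mulrn ?powR_ge0. Qed.

Let b_gt0 : 0 < b. Proof. exact: lt_le_trans ltr01 b_ge1. Qed.

Lemma tilt_amplitude_ge0 : 0 <= c.
Proof. by rewrite c_eq invr_ge0 mulr_ge0// exprn_ge0// ltW. Qed.

Let c_ge0 : 0 <= c := tilt_amplitude_ge0.

Let cb_le : c * b <= 2^-1.
Proof.
by rewrite c_eq expr2 !invfM -!mulrA mulVf ?gt_eqF// mulr1 ler_piMr// invf_le1.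
Qed.

Lemma tilt_amplitude_le : c <= 2^-1.
Proof. by apply: le_trans cb_le; rewrite ler_peMr. Qed.

Let c_le : c <= 2^-1 := tilt_amplitude_le.

Lemma gibbs_pdf_cosE x : gibbs_pdf V x = \prod_(i < d) cos_pdf b c (tnth x i).
Proof.
have expVE y : expR (- V y) =
      \prod_(i < d) ((normal_peak 1)^-1 * cos_tilt b c (tnth y i)).
  rewrite /cos_potential -/c opprB expRD mulr_sumr /sqnorm mulr_suml -sumrN.
  rewrite !expR_sum -big_split/=; apply: eq_bigr => i _.
  rewrite /cos_tilt mulrCA; congr *%R.
  rewrite normal_pdfE ?oner_eq0// mulKf ?gt_eqF ?normal_peak_gt0 ?oner_eq0//.
  by rewrite /normal_fun subr0 expr1n mulNr.
have pk0 : 0 < (normal_peak 1 : R)^-1.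
  by rewrite invr_gt0 normal_peak_gt0 ?oner_eq0.
have ZE : partition_function V =
    (\prod_(i < d) ((normal_peak 1)^-1 * cos_tilt_mass b c))%:E.
  rewrite /partition_function; under eq_integral do rewrite expVE.
  apply: (@integral_lebesgue_tuple_prod R d
    (fun _ t => (normal_peak 1)^-1 * cos_tilt b c t)
    (fun _ => (normal_peak 1)^-1 * cos_tilt_mass b c)).
  - by move=> _; apply: measurable_funM => //; exact: measurable_cos_tilt.
  - by move=> _ t; rewrite mulr_ge0 ?cos_tilt_ge0 ?(ltW pk0).
  - move=> _; under eq_integral do rewrite EFinM.
    rewrite ge0_integralZl//; last 3 first.
    + by apply/measurable_EFinP; exact: measurable_cos_tilt.
    + by move=> t _; rewrite lee_fin cos_tilt_ge0.
    + by rewrite lee_fin ltW.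
    by rewrite integral_cos_tilt.
rewrite /gibbs_pdf expVE ZE/= -prodf_div; apply: eq_bigr => i _.
by rewrite -mulf_div divff ?gt_eqF// mul1r.
Qed.

Lemma gradient_cosE x i :
  tnth (gradient V x) i = tnth x i + c * b * sin (b * tnth x i).
Proof.
rewrite /gradient tnth_mktuple.
pose s0 : R := \sum_(j < d | j != i) (tnth x j : R) ^+ 2.
pose s1 : R := \sum_(j < d | j != i) cos (b * (tnth x j : R)).
rewrite (_ : (fun t : R => _) =
    (fun t : R => (t ^+ 2 + s0) / 2 - c * (cos (b * t) + s1))); last first.
  apply/funext => t; rewrite /cos_potential /sqnorm -/b -/c.
  congr (_ / _ - _ * _); rewrite (bigD1 i)//= tnth_mktuple eqxx; congr (_ + _);
    by apply: eq_bigr => j ji; rewrite tnth_mktuple (negbTE ji).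
rewrite derive1E; set u := tnth x i : R.
have D : is_derive (u : R) 1
    (fun t : R => (t ^+ 2 + s0) / 2 - c * (cos (b * t) + s1))
    (u + c * b * sin (b * u)).
  apply: is_derive_eq.
  rewrite /GRing.scale/=.
  by field.
by rewrite derive_val.
Qed.

Lemma gaussian_pdfE (m : Rd) (s : R) y : 0 < s ->
  gaussian_pdf m (s ^+ 2) y = \prod_(i < d) normal_pdf (tnth m i) s (tnth y i).
Proof.
move=> s0; rewrite /gaussian_pdf.
under eq_bigr do rewrite normal_pdfE ?gt_eqF//.
rewrite big_split/= prodr_const card_ord; congr (_ * _).
  rewrite /normal_peak (_ : s ^+ 2 * pi *+ 2 = 2 * pi * s ^+ 2); last by ring.
  have a0 : 0 <= 2 * pi * s ^+ 2 by rewrite mulr_ge0 ?sqr_ge0// mulr_ge0// pi_ge0.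
  rewrite powRN [d%:R / 2]mulrC powRrM powR12_sqrt//.
  by rewrite powR_mulrn ?sqrtr_ge0// exprVn.
rewrite /normal_fun -expR_sum; congr expR.
rewrite /sqnorm -sumrN mulr_suml; apply: eq_bigr => i _.
by rewrite tnth_mktuple; congr (_ / _); ring.
Qed.

Let sigma : R := Num.sqrt (2 * h).

Let sigma_gt0 : 0 < sigma. Proof. by rewrite sqrtr_gt0 mulr_gt0. Qed.

Let sigma2 : sigma ^+ 2 = 2 * h.
Proof. by rewrite sqr_sqrtr// mulr_ge0// ltW. Qed.

Lemma mala_proposal_pdfE W x y : mala_proposal_pdf W h x y =
  \prod_(i < d)
    normal_pdf (tnth x i - h * tnth (gradient W x) i) sigma (tnth y i).
Proof.
rewrite /mala_proposal_pdf -sigma2 gaussian_pdfE//.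
by apply: eq_bigr => i _; rewrite tnth_mktuple.
Qed.

Lemma mala_proposal_pdf_gt0 W x y : 0 < mala_proposal_pdf W h x y.
Proof.
rewrite mala_proposal_pdfE; apply: prodr_gt0 => i _.
by rewrite normal_pdfE ?gt_eqF// mulr_gt0 ?expR_gt0// normal_peak_gt0 ?gt_eqF.
Qed.

Lemma integral_mala_proposal_pdf W x :
  (\int[lebesgue_tuple]_y (mala_proposal_pdf W h x y)%:E = 1)%E.
Proof.
under eq_integral do rewrite mala_proposal_pdfE.
rewrite (@integral_lebesgue_tuple_prod R d
  (fun i => normal_pdf (tnth x i - h * tnth (gradient W x) i) sigma) (fun=> 1)).
- by rewrite big1.
- by move=> i; exact: measurable_normal_pdf.
- by move=> i t; exact: normal_pdf_ge0.
- by move=> i; exact: integral_normal_pdf.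
Qed.

Lemma gibbs_pdf_cos_gt0 x : 0 < gibbs_pdf V x.
Proof.
rewrite divr_gt0 ?expR_gt0// fine_gt0// partition_function_gt0.
exact: partition_function_lty.
Qed.

Lemma measurable_gibbs_pdf_cos : measurable_fun setT (gibbs_pdf V : Rd -> R).
Proof.
apply: measurable_funM => //.
apply: measurableT_comp; first exact: measurable_expR.
by apply: measurableT_comp => //; exact: measurable_cos_potential.
Qed.

Lemma measurable_mala_proposal_cos :
  measurable_fun setT (fun z : Rd * Rd => mala_proposal_pdf V h z.1 z.2).
Proof.
under eq_fun do rewrite mala_proposal_pdfE.
apply: (@measurable_prod _ _ _ _ _ _ (fun i (z : Rd * Rd) =>
  normal_pdf (tnth z.1 i - h * tnth (gradient V z.1) i) sigma (tnth z.2 i)))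
  => i _.
rewrite (_ : (fun z : Rd * Rd => _) = (fun z : Rd * Rd =>
    normal_pdf 0 sigma (tnth z.2 i - (tnth z.1 i -
      h * (tnth z.1 i + c * b * sin (b * tnth z.1 i)))))); last first.
  apply/funext => z; rewrite gradient_cosE !normal_pdfE ?gt_eqF//.
  by rewrite [in RHS]/normal_fun subr0.
have m1 : measurable_fun setT (fun z : Rd * Rd => tnth z.1 i : R).
  by apply: (measurableT_comp (measurable_tnth i)); exact: measurable_fst.
have m2 : measurable_fun setT (fun z : Rd * Rd => tnth z.2 i : R).
  by apply: (measurableT_comp (measurable_tnth i)); exact: measurable_snd.
apply: (measurableT_comp (measurable_normal_pdf 0 sigma)).
apply: measurable_funB => //; apply: measurable_funB => //.
apply: measurable_funM => //; apply: measurable_funD => //.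
apply: measurable_funM => //; apply: measurableT_comp.
  by apply: continuous_measurable_fun; exact: continuous_sin.
exact: measurable_funM.
Qed.

Let k x y := mala_proposal_pdf V h x y * mala_acceptance V h x y.

Lemma measurable_mala_jump_cos :
  measurable_fun setT (fun z : Rd * Rd => k z.1 z.2).
Proof.
have mq := measurable_mala_proposal_cos.
have mq' : measurable_fun setT (fun z : Rd * Rd => mala_proposal_pdf V h z.2 z.1).
  by apply: (measurableT_comp mq (@measurable_swap _ _ _ _)).
have mp1 : measurable_fun setT (fun z : Rd * Rd => gibbs_pdf V z.1).
  by apply: (measurableT_comp measurable_gibbs_pdf_cos); exact: measurable_fst.
have mp2 : measurable_fun setT (fun z : Rd * Rd => gibbs_pdf V z.2).
  by apply: (measurableT_comp measurable_gibbs_pdf_cos); exact: measurable_snd.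
pose flow (z : Rd * Rd) := gibbs_pdf V z.1 * mala_proposal_pdf V h z.1 z.2.
pose back (z : Rd * Rd) := gibbs_pdf V z.2 * mala_proposal_pdf V h z.2 z.1.
have mflow : measurable_fun setT flow := measurable_funM mp1 mq.
have mback : measurable_fun setT back := measurable_funM mp2 mq'.
have mflowV : measurable_fun setT (fun z => (flow z)^-1).
  (* For [r >= 0] the inverse is the power [r `^ (-1)], which is measurable. *)
  rewrite (_ : (fun z => _) = (fun z => flow z `^ (-1))).
    exact: (measurableT_comp (measurable_powR (-1)) mflow).
  apply/funext => z; rewrite powR_inv1// /flow mulr_ge0// ltW//.
    exact: gibbs_pdf_cos_gt0.
  exact: mala_proposal_pdf_gt0.
have macc : measurable_fun setT (fun z : Rd * Rd => mala_acceptance V h z.1 z.2).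
  have := measurable_minr (measurable_cst (1 : R)) (measurable_funM mback mflowV).
  exact.
exact: (measurable_funM mq macc).
Qed.

Lemma mala_jump_cos_ge0 x y : 0 <= k x y.
Proof.
rewrite mulr_ge0 ?(ltW (mala_proposal_pdf_gt0 _ _ _))// le_min ler01/=.
by rewrite divr_ge0// mulr_ge0 ?ltW ?gibbs_pdf_cos_gt0 ?mala_proposal_pdf_gt0.
Qed.

Lemma mala_jump_cos_le x y : k x y <= mala_proposal_pdf V h x y.
Proof.
by rewrite ler_piMr ?(ltW (mala_proposal_pdf_gt0 _ _ _))// ge_min lexx.
Qed.

Lemma integral_mala_jump_cos_le x : (\int[lebesgue_tuple]_y (k x y)%:E <= 1)%E.
Proof.
rewrite -(integral_mala_proposal_pdf V x); apply: ge0_le_integral => //.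
- by move=> y _; rewrite lee_fin mala_jump_cos_ge0.
- apply/measurable_EFinP.
  exact: (measurableT_comp measurable_mala_jump_cos (measurable_pair1 x)).
- apply/measurable_EFinP.
  exact: (measurableT_comp measurable_mala_proposal_cos (measurable_pair1 x)).
- by move=> y _; rewrite lee_fin mala_jump_cos_le.
Qed.

Lemma mala_jump_cos_reversible x y :
  gibbs_pdf V x * k x y = gibbs_pdf V y * k y x.
Proof.
have flowE u v : gibbs_pdf V u * k u v = Num.min
    (gibbs_pdf V u * mala_proposal_pdf V h u v)
    (gibbs_pdf V v * mala_proposal_pdf V h v u).
  exact: metropolis_flow (gibbs_pdf_cos_gt0 u) (mala_proposal_pdf_gt0 V u v).
exact: (etrans (flowE x y) (etrans (minC _ _) (esym (flowE y x)))).
Qed.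

(** Writing the proposal as [u - v] plus noise, where [u] is the current
    coordinate and [v] the drift, [(t - u)^2 <= 2 (t - (u - v))^2 + 2 v^2].  The
    noise contributes [2 * 8 * 2 h = 32 h], and the gradient satisfies
    [g^2 <= (|u| + 1/2)^2 <= 2 u^2 + 1], so that [2 v^2 <= h (2 + 4 u^2)] as
    [h^2 <= h]. *)
Lemma mala_proposal_cos_sqr_step_le (j : 'I_d) x : h <= 1 ->
  (\int[lebesgue_tuple]_y
     ((tnth y j - tnth x j) ^+ 2 * mala_proposal_pdf V h x y)%:E <=
   (h * (34 + 4 * (tnth x j) ^+ 2))%:E)%E.
Proof.
move=> h1; set u : R := tnth x j.
set v := h * tnth (gradient V x) j.
pose phi t := 16 * sigma ^+ 2 * normal_pdf (u - v) (2 * sigma) t +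
  2 * v ^+ 2 * normal_pdf (u - v) sigma t.
apply: (@le_trans _ _ (16 * sigma ^+ 2 + 2 * v ^+ 2)%:E); last first.
  rewrite lee_fin sigma2.
  have g_le : tnth (gradient V x) j ^+ 2 <= 2 * u ^+ 2 + 1.
    rewrite gradient_cosE -/u.
    have s1 : (sin (b * u)) ^+ 2 <= 1.
      by rewrite -(cos2Dsin2 (b * u)) lerDr sqr_ge0.
    have cb2 : (c * b) ^+ 2 <= 2^-1 ^+ 2.
      by rewrite lerXn2r ?nnegrE// mulr_ge0// ltW.
    have := sqr_ge0 (u - c * b * sin (b * u)).
    have : (c * b) ^+ 2 * sin (b * u) ^+ 2 <= 2^-1 ^+ 2 * 1.
      by rewrite ler_pM ?sqr_ge0.
    by rewrite -exprMn; move: (c * b * sin _) => w; nra.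
  have h2 : h ^+ 2 <= h by rewrite expr2 ler_piMl// ltW.
  rewrite /v exprMn.
  have : h ^+ 2 * tnth (gradient V x) j ^+ 2 <= h * (2 * u ^+ 2 + 1).
    by rewrite ler_pM ?sqr_ge0.
  by move: (h ^+ 2 * _ ^+ 2) => w; lra.
under eq_integral do rewrite mala_proposal_pdfE.
apply: (@integral_tuple_coordinate_le R d j
  (fun i => normal_pdf (tnth x i - h * tnth (gradient V x) i) sigma)
  (fun t => (t - u) ^+ 2) phi).
- by apply: measurable_funX; exact: measurable_funB.
- by move=> t; exact: sqr_ge0.
- by apply: measurable_funD; apply: measurable_funM => //;
    exact: measurable_normal_pdf.
- move=> t; apply: addr_ge0; (apply: mulr_ge0; last exact: normal_pdf_ge0);
    by apply: mulr_ge0 => //; exact: sqr_ge0.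
- have a0 : 0 <= 16 * sigma ^+ 2 by rewrite mulr_ge0// sqr_ge0.
  have b0 : 0 <= 2 * v ^+ 2 by rewrite mulr_ge0// sqr_ge0.
  have mn a s :
      measurable_fun setT (fun t : R => (a * normal_pdf (u - v) s t)%:E).
    apply/measurable_EFinP; apply: measurable_funM => //.
    exact: measurable_normal_pdf.
  under eq_integral do rewrite EFinD.
  rewrite ge0_integralD//.
  + by rewrite !integral_scaled_normal_pdf.
  + by move=> t _; rewrite lee_fin mulr_ge0// normal_pdf_ge0.
  + exact: mn.
  + by move=> t _; rewrite lee_fin mulr_ge0// normal_pdf_ge0.
  + exact: mn.
- by move=> i; exact: measurable_normal_pdf.
- by move=> i t; exact: normal_pdf_ge0.
- by move=> i; exact: integral_normal_pdf.
move=> t; rewrite -/u -/v /phi.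
have := sqr_normal_pdf_le (u - v) t sigma_gt0.
have := normal_pdf_ge0 (u - v) sigma t.
move: (normal_pdf (u - v) sigma t) (normal_pdf _ _ t) => n n'.
move=> n0 H.
have : (t - u) ^+ 2 <= 2 * (t - (u - v)) ^+ 2 + 2 * v ^+ 2.
  by have := sqr_ge0 (t - u + v + v); nra.
move=> /(ler_wpM2r n0) /le_trans; apply; lra.
Qed.

End mala_densities.

(** * The clipped coordinate *)

Section bounded_L2.
Context d (T : measurableType d) (R : realType) (P : probability T R).

Lemma bounded_Lfun2 (f : T -> R) (M : R) : measurable_fun setT f ->
  (forall x, `|f x| <= M) -> f \in Lfun P 2%:E.
Proof.
move=> mf fM; rewrite inE; apply/andP; split; rewrite inE//=.
rewrite /finite_norm unlock poweR_lty//.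
apply: (@le_lt_trans _ _ (\int[P]_x (M ^+ 2)%:E)%E); last first.
  by rewrite integral_cst// ltey_eq fin_numM//; exact: fin_num_measure.
apply: ge0_le_integral => //.
- by move=> x _; rewrite poweR_ge0.
- apply/measurable_EFinP; apply: (measurableT_comp (measurable_powR 2)).
  exact: measurableT_comp.
- move=> x _; rewrite /= lee_fin powR_mulrn// lerXn2r// nnegrE//.
  exact: le_trans (fM x).
Qed.

End bounded_L2.

Section clipped_coordinate.
Context (R : realType).
Implicit Types t : R.

Definition clip t : R := Num.min (Num.max (t + 1) 0) 2.

Lemma measurable_clip : measurable_fun setT clip.
Proof.
apply: measurable_minr => //; apply: measurable_maxr => //.
exact: measurable_funD.
Qed.

Lemma clip_ge0 t : 0 <= clip t.
Proof. by rewrite le_min le_max lexx orbT ler0n. Qed.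

Lemma clip_le2 t : clip t <= 2.
Proof. by rewrite ge_min lexx orbT. Qed.

Lemma sqr_clipB_le t u : (clip t - clip u) ^+ 2 <= (t - u) ^+ 2.
Proof.
have H v w : v <= w -> 0 <= clip w - clip v <= w - v.
  rewrite /clip /Num.min /Num.max.
  by do !case: ifPn; rewrite -?leNgt => *; apply/andP; split; lra.
have [/H/andP[h0 h1]|/ltW/H/andP[h0 h1]] := leP t u.
  by rewrite -sqrrN -[leRHS]sqrrN !opprB lerXn2r// nnegrE// (le_trans h0).
by rewrite lerXn2r// nnegrE// (le_trans h0).
Qed.

(** Whatever the centre [m], one of the two ends of the range of [clip] is at
    distance at least 1 from it, and [clip] takes that value on a whole interval
    of length 1. *)
Lemma clip_far (m : R) : exists2 a : R, - 2 <= a <= 1 &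
  forall t, a <= t <= a + 1 -> 1 <= (clip t - m) ^+ 2.
Proof.
have [m1|m1] := leP m 1.
- exists 1; first by rewrite lexx andbT; lra.
  move=> t /andP[t1 t2]; rewrite (_ : clip t = 2); last first.
    by rewrite /clip max_l; [rewrite min_r//; lra|lra].
  by nra.
- exists (- 2); first by rewrite lexx; lra.
  move=> t /andP[t1 t2]; rewrite (_ : clip t = 0); last first.
    by rewrite /clip max_r; [rewrite min_l//|lra].
  by nra.
Qed.

End clipped_coordinate.

(** * Bounding the spectral gap *)

Section mala_gap.
Context (R : realType) (d : nat) (eta h : R).
Hypotheses (d_gt0 : (0 < d)%N) (eta_gt0 : 0 < eta).
Hypotheses (h_gt0 : 0 < h) (h_le1 : h <= 1).
Local Notation Rd := (euclidean R d).
Local Notation V := (@cos_potential R d eta).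
Let b : R := d%:R `^ eta.
Let c : R := (2 * d%:R `^ (2 * eta))^-1.
Let j : 'I_d := Ordinal d_gt0.
Let f (x : Rd) : R := clip (tnth x j).

Let c_ge0 : 0 <= c. Proof. exact: tilt_amplitude_ge0. Qed.
Let c_le : c <= 2^-1. Proof. exact: tilt_amplitude_le. Qed.

Let mf : measurable_fun setT f.
Proof.
by apply: (measurableT_comp (@measurable_clip R)); exact: measurable_tnth.
Qed.

Let p_ge0 (x : Rd) : 0 <= gibbs_pdf V x.
Proof. by rewrite ltW// gibbs_pdf_cos_gt0. Qed.

Let mp := @measurable_gibbs_pdf_cos R d eta.

(** By [clip_far], the squared deviation of [f] from its mean is at least 1 on a
    unit interval inside [-2, 2], where the density of the coordinate is bounded
    below. *)
Lemma variance_clip_ge :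
  ((expR (- 3) * normal_peak 1)%:E <= 'V_(pi_eta d eta)[f])%E.
Proof.
rewrite /variance unlock; set m := fine _; rewrite unlock.
have m_dev : measurable_fun setT (fun t : R => (clip t - m) ^+ 2).
  by apply: measurable_funX; apply: measurable_funB => //; exact: measurable_clip.
rewrite (ge0_integral_density (mu := lebesgue_tuple) mp p_ge0)//; last 2 first.
- apply/measurable_EFinP; apply: (measurableT_comp m_dev).
  exact: measurable_tnth.
- by move=> x; rewrite lee_fin sqr_ge0.
have [a /andP[a2 a1] afar] := clip_far m.
under eq_integral do rewrite gibbs_pdf_cosE//.
pose K : R := expR (- 3) * normal_peak 1.
have K0 : 0 <= K by rewrite mulr_ge0 ?expR_ge0 ?normal_peak_ge0.
apply: (@integral_tuple_coordinate_ge R d j (fun=> cos_pdf b c)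
  (fun t => (clip t - m) ^+ 2) (fun t => K * \1_`[a, a + 1] t)) => //.
- by apply: measurable_funM.
- by move=> t; rewrite mulr_ge0.
- under eq_integral do rewrite EFinM.
  have mI : measurable_fun setT (fun t : R => (\1_`[a, a + 1] t : R)%:E).
    by apply/measurable_EFinP.
  rewrite (ge0_integralZl lebesgue_measure measurableT mI)//.
  rewrite integral_indic//= setIT lebesgue_measure_itv/= lte_fin ltrDl ltr01.
  by rewrite -EFinB addrAC subrr add0r mule1.
- by move=> _; exact: measurable_cos_pdf.
- by move=> _ t; exact: cos_pdf_ge0.
- by move=> _; exact: integral_cos_pdf.
move=> t; have [ta|ta] := boolP (t \in `[a, a + 1]%classic).
  apply: le_trans (cos_pdf_bump_le b c_ge0 c_le t a2 a1) _.
  rewrite ler_peMl ?cos_pdf_ge0// afar//.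
  by move: ta; rewrite inE/= in_itv.
by rewrite indicE (negbTE ta) mulr0 mulr_ge0 ?sqr_ge0 ?cos_pdf_ge0.
Qed.

(** The second moment of the coordinate is at most [8 e], whence
    [34 + 4 * 8 e]. *)
Lemma dirichlet_form_clip_le :
  (2%:E * dirichlet_form (pi_eta d eta) (mala_kernel V h) f f <=
   (h * (34 + 32 * expR 1))%:E)%E.
Proof.
pose k (x y : Rd) := mala_proposal_pdf V h x y * mala_acceptance V h x y.
have k_ge0 x y : 0 <= k x y by exact: mala_jump_cos_ge0.
have mk : measurable_fun setT (fun z : Rd * Rd => k z.1 z.2).
  exact: measurable_mala_jump_cos.
have k_le1 x : (\int[lebesgue_tuple]_y (k x y)%:E <= 1)%E.
  exact: integral_mala_jump_cos_le.
have k_rev x y : gibbs_pdf V x * k x y = gibbs_pdf V y * k y x.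
  exact: mala_jump_cos_reversible.
have PE (A : set Rd) : measurable A ->
  pi_eta d eta A = (\int[lebesgue_tuple]_(x in A) (gibbs_pdf V x)%:E)%E by [].
have KE x (B : set Rd) : mala_kernel V h x B =
  (\int[lebesgue_tuple]_(y in B) (k x y)%:E +
   (\1_B x)%:E * (1 - \int[lebesgue_tuple]_y (k x y)%:E))%E by [].
have f_ge0 x : 0 <= f x by exact: clip_ge0.
have f_le2 x : f x <= 2 by exact: clip_le2.
rewrite (dirichlet_form_jump mp p_ge0 PE mk k_ge0 k_le1 k_rev KE mf f_ge0 f_le2).
apply: (@le_trans _ _ (\int[lebesgue_tuple]_x
    ((h * (34 + 4 * (tnth x j) ^+ 2)) * gibbs_pdf V x)%:E)%E).
  apply: ge0_le_integral => //.
  - move=> x _; apply: integral_ge0 => y _.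
    by rewrite lee_fin mulr_ge0 ?sqr_ge0// mulr_ge0.
  - pose F (z : Rd * Rd) :=
      (gibbs_pdf V z.1 * k z.1 z.2 * (f z.1 - f z.2) ^+ 2)%:E.
    apply: (@measurable_fun_fubini_tonelli_F _ _ _ _ R lebesgue_tuple F);
      last first.
      by move=> z; rewrite /F lee_fin mulr_ge0 ?sqr_ge0// mulr_ge0.
    apply/measurable_EFinP; apply: measurable_funM.
      apply: (measurable_funM _ mk).
      exact: (measurableT_comp mp measurable_fst).
    apply: measurable_funX; apply: measurable_funB.
      exact: (measurableT_comp mf measurable_fst).
    exact: (measurableT_comp mf measurable_snd).
  - apply/measurable_EFinP; apply: (measurable_funM _ mp).
    apply: measurable_funM => //; apply: measurable_funD => //.
    apply: measurable_funM => //; apply: measurable_funX.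
    exact: measurable_tnth.
  move=> x _.
  pose G y := (tnth y j - tnth x j) ^+ 2 * mala_proposal_pdf V h x y.
  have mG : measurable_fun setT (fun y => (G y)%:E).
    apply/measurable_EFinP; apply: measurable_funM.
      apply: measurable_funX; apply: measurable_funB => //.
      exact: measurable_tnth.
    have mq := @measurable_mala_proposal_cos R d eta h h_gt0.
    exact: (measurableT_comp mq (measurable_pair1 x)).
  have G_ge0 y : (0 <= (G y)%:E)%E.
    by rewrite lee_fin mulr_ge0 ?sqr_ge0// ltW// mala_proposal_pdf_gt0.
  apply: (@le_trans _ _ ((gibbs_pdf V x)%:E * \int[lebesgue_tuple]_y (G y)%:E)%E).
    rewrite -ge0_integralZl//; last by rewrite lee_fin.
    apply: ge0_le_integral => //.
    - by move=> y _; rewrite lee_fin mulr_ge0 ?sqr_ge0// mulr_ge0.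
    - apply/measurable_EFinP.
      have mkx : measurable_fun setT (k x).
        exact: (measurableT_comp mk (measurable_pair1 x)).
      have mdf : measurable_fun setT (fun y : Rd => (f x - f y) ^+ 2).
        by apply: measurable_funX; apply: measurable_funB.
      have mpx := measurable_funM (measurable_cst (gibbs_pdf V x)) mkx.
      exact: (measurable_funM mpx mdf).
    - exact: measurable_funeM.
    move=> y _; rewrite -EFinM lee_fin -mulrA ler_wpM2l// mulrC ler_pM ?sqr_ge0//.
      by rewrite -sqrrN opprB sqr_clipB_le.
    exact: mala_jump_cos_le.
  rewrite [X in (_ <= X%:E)%E]mulrC (EFinM (gibbs_pdf V x)).
  apply: lee_wpmul2l.
    by rewrite lee_fin.
  exact: mala_proposal_cos_sqr_step_le.
under eq_integral do rewrite gibbs_pdf_cosE//.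
pose phi t := 34 * h * cos_pdf b c t + 32 * h * expR 1 * normal_pdf 0 2 t.
have h0 : 0 <= h by exact: ltW.
have e0 : 0 <= 32 * h * expR 1 by rewrite !mulr_ge0 ?expR_ge0.
apply: (@integral_tuple_coordinate_le R d j (fun=> cos_pdf b c)
  (fun t => h * (34 + 4 * t ^+ 2)) phi).
- apply: measurable_funM => //; apply: measurable_funD => //.
  by apply: measurable_funM => //; exact: measurable_funX.
- by move=> t; rewrite mulr_ge0// addr_ge0// mulr_ge0 ?sqr_ge0.
- apply: measurable_funD; apply: measurable_funM => //.
    exact: measurable_cos_pdf.
  exact: measurable_normal_pdf.
- move=> t; apply: addr_ge0; apply: mulr_ge0 => //.
  + by rewrite mulr_ge0.
  + exact: cos_pdf_ge0.
  + exact: normal_pdf_ge0.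
- under eq_integral do rewrite EFinD.
  have h34 : 0 <= 34 * h by rewrite mulr_ge0.
  rewrite ge0_integralD//.
  + rewrite integral_scaled_normal_pdf//.
    under eq_integral do rewrite EFinM.
    rewrite ge0_integralZl//.
    * rewrite integral_cos_pdf// mule1 -EFinD; congr EFin; ring.
    * by apply/measurable_EFinP; exact: measurable_cos_pdf.
    * by move=> t _; rewrite lee_fin cos_pdf_ge0.
  + by move=> t _; rewrite lee_fin mulr_ge0// cos_pdf_ge0.
  + apply/measurable_EFinP; apply: measurable_funM => //.
    exact: measurable_cos_pdf.
  + by move=> t _; rewrite lee_fin mulr_ge0// normal_pdf_ge0.
  + apply/measurable_EFinP; apply: measurable_funM => //.
    exact: measurable_normal_pdf.
- by move=> _; exact: measurable_cos_pdf.
- by move=> _ t; exact: cos_pdf_ge0.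
- by move=> _; exact: integral_cos_pdf.
move=> t; rewrite /phi.
have := sqr_cos_pdf_le b c_ge0 c_le t => /(ler_wpM2l h0).
move: (cos_pdf b c t) (normal_pdf 0 2 t) => r n; lra.
Qed.

Lemma spectral_gap_mala_le :
  (spectral_gap (pi_eta d eta) (mala_kernel V h) <=
   ((17 + 16 * expR 1) / (expR (- 3) * normal_peak 1) * h)%:E)%E.
Proof.
set kappa := expR (- 3) * normal_peak 1.
have kappa_gt0 : 0 < kappa.
  by rewrite mulr_gt0 ?expR_gt0// normal_peak_gt0// oner_eq0.
have fL2 : f \in Lfun (pi_eta d eta) 2%:E.
  apply: (@bounded_Lfun2 _ _ _ _ _ 2) => // x.
  by rewrite ger0_norm ?clip_ge0// clip_le2.
have := variance_clip_ge; rewrite -/kappa => kappa_le.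
have := dirichlet_form_clip_le.
set D := dirichlet_form _ _ _ _; set v := 'V_(_)[f] in kappa_le *.
rewrite -lee_pdivlMl// => D_le.
have v_gt0 : (0 < v)%E by apply: lt_le_trans kappa_le; rewrite lte_fin.
apply: (@le_trans _ _ (D / v)%E).
  by apply: ereal_inf_lbound; exists f => //; split.
have /fineK vE : v \is a fin_num by exact: variance_fin_num.
move: kappa_le v_gt0; rewrite -vE; move: (fine v) => w.
rewrite lee_fin lte_fin => kw w0.
rewrite inver gt_eqF// (le_trans (lee_wpmul2r _ D_le))//.
  by rewrite lee_fin invr_ge0 ltW.
rewrite -!EFinM lee_fin.
rewrite [leRHS](_ : _ = 2^-1 * (h * (34 + 32 * expR 1)) * kappa^-1).
  rewrite ler_wpM2l ?lef_pV2 ?posrE//.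
  by rewrite !mulr_ge0 ?addr_ge0 ?mulr_ge0 ?expR_ge0 ?ltW.
by field; rewrite gt_eqF.
Qed.

End mala_gap.

Unset Implicit Arguments.

Theorem theorem9 (R : realType) :
  exists C : R, 0 < C /\
    forall (d : nat) (eta h : R),
      (1 <= d)%N -> 0 < eta -> eta < 4^-1 -> 0 < h -> h <= 1 ->
      (spectral_gap (pi_eta d eta) (mala_kernel (cos_potential d eta) h)
         <= (C * h)%:E)%E.
Proof.
exists ((17 + 16 * expR 1) / (expR (- 3) * normal_peak 1)); split.
  apply: divr_gt0; first by have := expR_gt0 (1 : R); lra.
  by rewrite mulr_gt0 ?expR_gt0// normal_peak_gt0// oner_eq0.
by move=> d eta h d_gt0 eta_gt0 _; exact: spectral_gap_mala_le.
Qed.
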